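(* Let $A\in\mathbb{R}^{n\times n}$ be symmetric, let $g\in\mathbb{R}^n$ be nonzero, let $\Delta>0$, and set $$M=\begin{pmatrix}-A & \frac{gg^T}{\Delta^2}\\ I & -A\end{pmatrix}\in\mathbb{R}^{2n\times 2n}.$$ Let $\hat\lambda\in\mathbb{R}$ and let $\hat y=\begin{pmatrix}\hat y_1\\ \hat y_2\end{pmatrix}\in\mathbb{R}^{2n}$, with $\hat y_1,\hat y_2\in\mathbb{R}^n$ and $\|\hat y\|=1$, be such that $(\hat\lambda,\hat y)$ is an approximation to the rightmost eigenpair of $M$, with $\hat y_1\neq 0$ and $g^T\hat y_2\neq 0$. Let $\hat s\in\mathbb{R}^n$ be the vector recovered from $\hat y$ by $$\hat s=-\frac{\Delta^2}{g^T\hat y_2}\,\hat y_1=-\operatorname{sign}(g^T\hat y_2)\,\Delta\,\frac{\hat y_1}{\|\hat y_1\|}$$ (both equalities being assumed to hold). Then $$\|(A+\hat\lambda I)\hat s+g\|\le\frac{\Delta}{\|\hat y_1\|}\,\|(M-\hat\lambda I)\hat y\|.$$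
   Context: $\|\cdot\|$ is the Euclidean norm of a vector and $I$ is an identity matrix of the appropriate size. The matrix $M$ arises from the trust-region subproblem $\min_{\|s\|\le\Delta} g^Ts+\frac12 s^TAs$. The phrase ''approximation to the rightmost eigenpair of $M$'' (the eigenvalue of largest real part and an associated eigenvector) imposes no quantitative accuracy requirement: $(\hat\lambda,\hat y)$ may be any real pair with the stated properties. *)

(* Defs.v *)
From mathcomp Require Import all_boot all_order all_algebra.
From mathcomp Require Import reals.

Set Implicit Arguments.
Unset Strict Implicit.
Unset Printing Implicit Defensive.

Import Order.TTheory GRing.Theory Num.Theory.
Local Open Scope ring_scope.

(* The norm that MathComp-Analysis puts on matrices is the sup norm, hence
   an explicit Euclidean norm. *)
Definition norm2 (R : realType) (m : nat) (v : 'cV[R]_m) : R :=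
  Num.sqrt (\sum_(i < m) v i 0 ^+ 2).

Definition dotv (R : realType) (m : nat) (u v : 'cV[R]_m) : R :=
  (u^T *m v) 0 0.

(* The matrix M of the trust-region subproblem
   min { g^T s + s^T A s / 2 : |s| <= Delta }. *)
Definition trs_mx (R : realType) (n : nat) (A : 'M[R]_n) (g : 'cV[R]_n)
    (Delta : R) : 'M[R]_(n + n) :=
  block_mx (- A) ((Delta ^+ 2)^-1 *: (g *m g^T))
           1%:M  (- A).

(* Main.v *)
Require Import Defs.
From mathcomp Require Import all_boot all_order all_algebra.
From mathcomp Require Import reals.

Set Implicit Arguments.
Unset Strict Implicit.
Unset Printing Implicit Defensive.

Import Order.TTheory GRing.Theory Num.Theory.
Local Open Scope ring_scope.

(** Write [r1] for the upper block of the residual [(M - lambda) y] and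
[c = Delta^2 / (g^T y2)].  The recovery formula [s = - c y1] is exactly what
turns [r1 = - (A + lambda) y1 + c^-1 g] into the residual of the linear system:
[(A + lambda) s + g = c r1] (lemma [recovered_residual]).  The two expressions
for [s] are multiples of the same nonzero vector [y1], so their coefficients
agree, which forces [|c| = Delta / |y1|].  The bound follows, since dropping
the lower block of a vector does not increase its Euclidean norm. *)

Lemma norm2_ge0 (R : realType) (m : nat) (v : 'cV[R]_m) : 0 <= norm2 v.
Proof. exact: sqrtr_ge0. Qed.

Lemma norm2Z (R : realType) (m : nat) (a : R) (v : 'cV[R]_m) :
  norm2 (a *: v) = `|a| * norm2 v.
Proof.
rewrite /norm2 -sqrtr_sqr -sqrtrM ?sqr_ge0 // mulr_sumr.
by congr Num.sqrt; apply: eq_bigr => i _; rewrite mxE exprMn.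
Qed.

Lemma norm2_le_col_mx (R : realType) (m p : nat) (u : 'cV[R]_m)
    (v : 'cV[R]_p) : norm2 u <= norm2 (col_mx u v).
Proof.
apply: ler_wsqrtr; rewrite big_split_ord /=.
under [X in _ <= X + _]eq_bigr => i _ do rewrite col_mxEu.
by rewrite lerDl; apply: sumr_ge0 => i _; exact: sqr_ge0.
Qed.

Lemma scaler_inj_l (F : fieldType) (V : lmodType F) (a b : F) (v : V) :
  v != 0 -> a *: v = b *: v -> a = b.
Proof.
move=> v0 /eqP; rewrite -subr_eq0 -scalerBl scaler_eq0 (negPf v0) orbF.
by rewrite subr_eq0 => /eqP.
Qed.

Lemma trs_mx_residual (R : realType) (n : nat) (A : 'M[R]_n) (g : 'cV[R]_n)
    (Delta lambda : R) (y1 y2 : 'cV[R]_n) :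
  (trs_mx A g Delta - lambda%:M) *m col_mx y1 y2 =
  col_mx (- ((A + lambda%:M) *m y1) + (dotv g y2 / Delta ^+ 2) *: g)
         (y1 - (A + lambda%:M) *m y2).
Proof.
rewrite mulmxBl /trs_mx mul_block_col (mul_scalar_mx lambda) scale_col_mx.
rewrite opp_col_mx add_col_mx mul1mx -scalemxAl -mulmxA.
rewrite [g^T *m y2]mx11_scalar mul_mx_scalar scalerA -/(dotv g y2).
rewrite !mulmxDl !mul_scalar_mx !mulNmx [_^-1 * _]mulrC.
by congr col_mx; rewrite !opprD ?addrA // addrAC.
Qed.

(** With [c = Delta^2 / (g^T y2)], the right-hand vector is the upper block of
[trs_mx_residual]: scaling by [c] makes the coefficient of [g] equal to one and
turns [y] into the recovered step, up to sign. *)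
Lemma recovered_residual (R : realType) (n : nat) (B : 'M[R]_n)
    (g y : 'cV[R]_n) (c : R) : c != 0 ->
  B *m (- c *: y) + g = c *: (- (B *m y) + c^-1 *: g).
Proof.
move=> c0.
by rewrite scalerDr scalerA divff // scale1r -scalemxAr scalerN scaleNr.
Qed.

Theorem theorem4p1 (R : realType) (n : nat) (A : 'M[R]_n) (g : 'cV[R]_n)
    (Delta : R) (lambda : R) (y1 y2 s : 'cV[R]_n)
    (A_sym : A^T = A) (g_neq0 : g <> 0) (Delta_gt0 : 0 < Delta)
    (y_unit : norm2 (col_mx y1 y2) = 1)
    (y1_neq0 : y1 <> 0) (gy2_neq0 : dotv g y2 <> 0)
    (s_def : s = - (Delta ^+ 2 / dotv g y2) *: y1)
    (s_sign : s = - (Num.sg (dotv g y2) * Delta) *: ((norm2 y1)^-1 *: y1)) :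
  norm2 ((A + lambda%:M) *m s + g)
    <= Delta / norm2 y1
       * norm2 ((trs_mx A g Delta - lambda%:M) *m col_mx y1 y2).
Proof.
have y1_neq0' : y1 != 0 by apply/eqP.
have d0 : dotv g y2 != 0 by apply/eqP.
set c := Delta ^+ 2 / dotv g y2 in s_def.
have c0 : c != 0 by rewrite mulf_neq0 ?invr_eq0 // expf_neq0 // gt_eqF.
have normc : `|c| = Delta / norm2 y1.
  move: s_sign; rewrite s_def scalerA => /(scaler_inj_l y1_neq0').
  rewrite mulNr => /oppr_inj ->.
  rewrite !normrM normr_sg d0 mul1r gtr0_norm //.
  by rewrite ger0_norm // invr_ge0 norm2_ge0.
rewrite trs_mx_residual s_def recovered_residual // norm2Z normc invf_div.
apply: ler_wpM2l; last exact: norm2_le_col_mx.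
by rewrite -normc.
Qed.
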